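(* Let $\phi:[0,1]\to[-\infty,\infty]$ be a continuous strictly monotonic function that is integrable, i.e. $\int_0^1|\phi(u)|\,du<\infty$, and let $\psi$ be its inverse (with domain $\phi([0,1])$). Then for every $K\in\{2,3,\dots\}$, every $\epsilon\in(0,1]$, and all random variables $p_1,\dots,p_K$ defined on a common probability space, each uniformly distributed on $[0,1]$ (with arbitrary dependence), $$\mathbb{P}\left(M_{\phi,K}(p_1,\dots,p_K)\le\psi\left(\frac1\epsilon\int_0^\epsilon\phi(u)\,du\right)\right)\le\epsilon .$$
   Context: For a continuous strictly monotonic $\phi:[0,1]\to[-\infty,\infty]$ with inverse $\psi:\phi([0,1])\to[0,1]$, define $M_{\phi,K}(p_1,\dots,p_K):=\psi\left(\frac{\phi(p_1)+\dots+\phi(p_K)}{K}\right)$. (Infinite values of $\phi$ can occur only at the endpoints $0,1$; so for uniformly distributed $p_k$ the sum is well defined and finite almost surely.) *)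

(* Defs.v *)
(* MathComp / MathComp-Analysis *)
From HB Require Import structures.
From mathcomp Require Import all_boot all_order all_algebra.
From mathcomp Require Import all_classical all_reals all_analysis.

Set Implicit Arguments.
Unset Strict Implicit.
Unset Printing Implicit Defensive.

Import Order.TTheory GRing.Theory Num.Theory.
Import numFieldNormedType.Exports.

Local Open Scope classical_set_scope.
Local Open Scope ring_scope.

(* A function on [0,1] is represented by a total function on R whose values
   outside [0,1] are irrelevant. *)
Definition strictly_monotonic01 (R : realType) (phi : R -> \bar R) : Prop :=
  {in `[0, 1] &, {homo phi : x y / x < y >-> (x < y)%E}} \/
  {in `[0, 1] &, {homo phi : x y / x < y >-> (y < x)%E}}.

(* The generalized mean psi ((phi x_1 + ... + phi x_K) / K); psi is meant to be
   the inverse of phi on phi @` `[0, 1].  In \bar R one has -oo + +oo = -oo,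
   which only concerns points with one coordinate equal to 0 and another equal
   to 1, where the mean is mathematically undefined. *)
Definition gen_mean (R : realType) (phi : R -> \bar R) (psi : \bar R -> R)
    (K : nat) (x : 'I_K -> R) : R :=
  psi ((\sum_(k < K) phi (x k)) * (K%:R^-1)%:E)%E.

(* Laws are compared on measurable sets only, since the values of a measure on
   the other sets are unspecified. *)
Definition uniform01 d (T : measurableType d) (R : realType)
    (P : probability T R) (X : {RV P >-> R}) : Prop :=
  forall A : set R, measurable A ->
    distribution P X A = uniform_prob (@ltr01 R) A.

(* Main.v *)
Require Import Defs.
From HB Require Import structures.
From mathcomp Require Import all_boot all_order all_algebra.
From mathcomp Require Import all_classical all_reals all_analysis.
From mathcomp Require Import measurable_realfun ring.

Set Implicit Arguments.
Unset Strict Implicit.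
Unset Printing Implicit Defensive.

Import Order.TTheory GRing.Theory Num.Theory.
Import numFieldNormedType.Exports.

Local Open Scope classical_set_scope.
Local Open Scope ring_scope.

(** Take phi increasing and eps < 1 (for eps = 1 the bound is trivial); put
t = phi eps and c = (1/eps) * int_0^eps phi, so that c < t.  The excess
h(u) = max (t - phi u) 0 vanishes beyond eps, hence its integral over [0,1] is
eps * (t - c) ([integral_excess]).  If the mean of the phi (p k) is at most c,
then the sum of the K excesses h (p k) is at least K * (t - c)
([sum_excess_ge]).  The expectation of that sum is K * eps * (t - c), whatever
the dependence between the p k, because each p k is uniform; Markov's
inequality ([markov_sum_uniform01]) then bounds the probability by eps
([increasing_mean_bound]).

For a decreasing phi the event reads c <= mean of the phi (p k), and the bound
for increasing functions applies to - phi.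

To pass from psi (mean) <= psi c to an inequality between the mean and c, both
must lie in the image of phi, since psi is unconstrained elsewhere.  They lie
between phi 0 and phi 1 ([mean_between], [average_between]), and the
intermediate value theorem for extended-real functions ([ereal_IVT]) gives the
rest.  The resulting description also shows that the event is measurable. *)

(** * Intermediate values of extended-real functions *)

(** The distance on the extended reals is, by construction, the one pulled back
along [contract], which is thus an isometry onto its image. *)
Lemma continuous_contract (R : realType) : continuous (@contract R).
Proof.
move=> x; apply/cvg_ballP => e e0.
exact: (nbhsx_ballx (x : \bar R) e e0).
Qed.

(** The real theorem applied to [contract \o f], since [contract] is increasing
and injective; infinite end values of f are thereby included. *)
Lemma ereal_IVT (R : realType) (f : R -> \bar R) (a b : R) (v : \bar R) :
  a <= b -> {within `[a, b], continuous f} ->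
  (mine (f a) (f b) <= v <= maxe (f a) (f b))%E ->
  exists2 c, c \in `[a, b] & f c = v.
Proof.
move=> ab cf /andP[fv vf].
have cnt : {within `[a, b], continuous (@contract R \o f)}.
  move=> x; apply: (@continuous_comp (subspace `[a, b]) _ _ f).
    exact: cf.
  exact: continuous_contract.
have [|c cab /contract_inj fcv] := @IVT R _ a b (contract v) ab cnt;
  last by exists c.
move: fv vf; rewrite /= !minEle !maxEle !le_contract.
by case: ifP => _ fv vf; rewrite !le_contract fv vf.
Qed.

(** * Expectations of functions of uniform variables *)

(** Both sides are restricted to [0,1] because h is controlled only there. *)
Lemma ge0_integral_uniform01 d (T : measurableType d) (R : realType)
    (P : probability T R) (X : {RV P >-> R}) (h : R -> \bar R) :
  uniform01 X -> measurable_fun (`[0, 1] : set R) h ->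
  (forall u, u \in `[0, 1] -> (0 <= h u)%E) ->
  (\int[P]_(w in X @^-1` `[0%R, 1%R]) h (X w) =
   \int[@lebesgue_measure R]_(u in `[0%R, 1%R]) h u)%E.
Proof.
move=> uX mh h0.
have mI : measurable (`[0, 1] : set R) by exact: measurable_itv.
have h0' (u : R) : `[0, 1]%classic u -> (0 <= h u)%E by move=> /= /h0.
(* The Lebesgue measure lives on a copy of R with another display, so X is
   read as a map into that copy before its law is compared. *)
pose Y : T -> measurableTypeR R := X.
have mY : measurable_fun setT Y by exact: (measurable_funP X).
have <- // := ge0_integral_pushforward mY P (D := `[0, 1]%classic) (f := h);
  last by move=> u; rewrite inE => /h0'.
transitivity (\int[uniform_prob (@ltr01 R)]_(u in `[0%R, 1%R]) h u)%E.
  by apply: eq_measure_integral => A mA _; exact: uX.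
rewrite integral_mkcond integral_uniform//.
- by rewrite subr0 invr1 mul1e -integral_mkcondr setIid//.
- by apply/(measurable_restrict _ mI) => //; rewrite setTI.
- by move=> u; rewrite patchE; case: ifPn => //; rewrite inE => /h0'.
Qed.

(** Markov's inequality for the sum of the h (p k): linearity of the expectation
makes the joint law irrelevant. *)
Lemma markov_sum_uniform01 d (T : measurableType d) (R : realType)
    (P : probability T R) (K : nat) (p : 'I_K -> {RV P >-> R})
    (h : R -> \bar R) (a : R) (E : set T) :
  (forall k, uniform01 (p k)) -> measurable_fun (`[0, 1] : set R) h ->
  (forall u, u \in `[0, 1] -> (0 <= h u)%E) ->
  measurable E -> (forall w k, E w -> p k w \in `[0, 1]) ->
  (forall w, E w -> a%:E <= \sum_(k < K) h (p k w))%E -> 0 <= a ->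
  (a%:E * P E <= K%:R%:E * \int[@lebesgue_measure R]_(u in `[0%R, 1%R]) h u)%E.
Proof.
move=> up mh h0 mE E01 Ea a0.
have mI : measurable (`[0, 1] : set R) by exact: measurable_itv.
have mD k : measurable (p k @^-1` (`[0, 1] : set R)).
  by rewrite -[X in measurable X]setTI; exact: measurable_funP.
have mhp k : measurable_fun (p k @^-1` (`[0, 1] : set R)) (fun w => h (p k w)).
  apply: (measurable_comp mI) => //.
  - by move=> _ [w + <-].
  - exact: measurable_funTS.
have hE k : measurable_fun E (fun w => h (p k w)).
  by apply: measurable_funS (mhp k) => // w Ew; exact: E01.
have h0E k w : E w -> (0 <= h (p k w))%E by move=> Ew; exact/h0/E01.
rewrite -integral_cst//.
apply: (@le_trans _ _ (\int[P]_(w in E) \sum_(k < K) h (p k w))%E).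
  apply: ge0_le_integral => //.
  by apply: emeasurable_sum.
rewrite ge0_integral_sum//.
apply: (@le_trans _ _
    (\sum_(k < K) \int[@lebesgue_measure R]_(u in `[0%R, 1%R]) h u)%E).
  apply: lee_sum => k _; rewrite -(ge0_integral_uniform01 (up k))//.
  apply: ge0_subset_integral => //.
  - by move=> w /= /h0.
  - by move=> w Ew; exact: E01.
by rewrite sumr_const card_ord -[X in (X <= _)%E]mule_natl.
Qed.

(** * Means of extended reals *)

(** Sum the inequalities t <= x k + max (t - x k) 0.  These fail exactly where
x k = -oo, but then the right-hand sum is +oo. *)
Lemma sum_excess_ge (R : realType) (K : nat) (x : 'I_K -> \bar R) (c t : R) :
  (\sum_(k < K) x k <= (K%:R * c)%:E)%E ->
  ((K%:R * (t - c))%:E <= \sum_(k < K) maxe (t%:E - x k) 0)%E.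
Proof.
move=> xc.
have m0 k : (0 <= maxe (t%:E - x k) 0)%E by rewrite le_max lexx orbT.
have [[k xk]|nx] := pselect (exists k, x k = -oo%E).
  rewrite (bigD1 k)//= xk /= addye ?maxye ?leey//.
  by rewrite gt_eqF// (lt_le_trans ltNy0)// sume_ge0.
have tx k : (t%:E <= x k + maxe (t%:E - x k) 0)%E.
  case: (x k) (contra_not (ex_intro _ k) nx) => [r _||//].
  - by rewrite -EFinB -EFin_max -EFinD lee_fin -lerBlDl le_max lexx.
  - by rewrite addye ?leey// gt_eqF// (lt_le_trans ltNy0)// le_max lexx orbT.
rewrite mulrBr EFinB leeBlDl//.
apply: le_trans (leeD xc (lexx _)); rewrite -big_split/=.
apply: le_trans (lee_sum _ (fun k _ => tx k)).
by rewrite sumEFin sumr_const card_ord mulr_natl.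
Qed.

(** Negation does not commute with extended sums in which both infinities
occur (-oo + +oo = -oo); the lower bound y excludes the value -oo. *)
Lemma sume_leN (R : realType) (K : nat) (x : 'I_K -> \bar R) (y : \bar R) :
  y \is a fin_num -> (y <= \sum_(k < K) x k)%E ->
  (\sum_(k < K) - x k <= - y)%E.
Proof.
move=> fy yx.
have nx k : x k != -oo%E.
  apply/eqP => xk; move: yx; rewrite (bigD1 k)//= xk addNye leNgt.
  by rewrite ltNye_eq fy.
rewrite sumeN ?leeN2// => i j _ _; move: (nx i) (nx j).
by case: (x i) (x j) => [?||] [?||].
Qed.

Lemma mean_between (R : realType) (K : nat) (x : 'I_K -> \bar R)
    (lo hi : \bar R) :
  (0 < K)%N -> (forall k, lo <= x k <= hi)%E ->
  (lo <= (\sum_(k < K) x k) * (K%:R^-1)%:E <= hi)%E.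
Proof.
move=> K0 xb.
have Kr0 : 0 < K%:R :> R by rewrite ltr0n.
rewrite lee_pdivlMr// lee_pdivrMr// !(muleC _ K%:R%:E) !mule_natl.
have cstE (y : \bar R) : (y *+ K = \sum_(k < K) y)%E.
  by rewrite sumr_const card_ord.
by rewrite !cstE; apply/andP; split; apply: lee_sum => k _; case/andP: (xb k).
Qed.

(** * Integrals of monotone functions over [0,eps] *)

Lemma lebesgue_measure_0itv (R : realType) (a : R) :
  0 < a -> (@lebesgue_measure R) `[0, a] = a%:E.
Proof. by move=> a0; rewrite lebesgue_measure_itv/= lte_fin a0 oppr0 addr0. Qed.

Lemma lebesgue_integrable_cst (R : realType) (a r : R) :
  (@lebesgue_measure R).-integrable `[0, a] (cst r%:E).
Proof.
apply/integrableP; split => //.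
rewrite (eq_integral (cst `|r|%:E))// integral_cst//.
rewrite [X in (_ * X)%E]lebesgue_measure_itv/=.
by case: ifP => _; rewrite ?mule0 ?ltry// -EFinB -EFinM ltry.
Qed.

(** The hypothesis lo < hi rules out lo = +oo and hi = -oo. *)
Lemma average_between (R : realType) (f : R -> \bar R) (eps : R)
    (lo hi : \bar R) :
  0 < eps -> (@lebesgue_measure R).-integrable `[0, eps] f -> (lo < hi)%E ->
  (forall u, u \in `[0, eps] -> (lo <= f u <= hi)%E) ->
  (lo <= (eps^-1)%:E * \int[@lebesgue_measure R]_(u in `[0%R, eps]) f u
      <= hi)%E.
Proof.
move=> e0 fint lohi fb.
have mI : measurable (`[0, eps] : set (measurableTypeR R)).
  exact: measurable_itv.
have mue := lebesgue_measure_0itv e0.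
apply/andP; split.
- case: lo fb lohi => [r||] fb lohi; last by rewrite leNye.
    2: by rewrite ltNge leey in lohi.
  rewrite lee_pdivlMl// -mue muleC -integral_cst//.
  apply: le_integral => //; first exact: lebesgue_integrable_cst.
  by move=> u; rewrite inE => /fb/andP[].
- case: hi fb lohi => [r||] fb lohi; last by rewrite ltNge leNye in lohi.
    2: by rewrite leey.
  rewrite lee_pdivrMl// -mue muleC -integral_cst//.
  apply: le_integral => //; first exact: lebesgue_integrable_cst.
  by move=> u; rewrite inE => /fb/andP[].
Qed.

Lemma integral_cstB (R : realType) (f : R -> \bar R) (eps t : R) :
  0 < eps -> (@lebesgue_measure R).-integrable `[0, eps] f ->
  (\int[@lebesgue_measure R]_(u in `[0%R, eps]) (t%:E - f u) =
   (eps * t)%:E - \int[@lebesgue_measure R]_(u in `[0%R, eps]) f u)%E.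
Proof.
move=> e0 fint.
have mI : measurable (`[0, eps] : set (measurableTypeR R)).
  exact: measurable_itv.
have := integralB mI (lebesgue_integrable_cst eps t) fint.
rewrite integral_cst// [X in (_ * X)%E](lebesgue_measure_0itv e0).
by rewrite -EFinM (mulrC t).
Qed.

(** For a nondecreasing f, the positive part of f eps - f is f eps - f on
[0,eps] and zero on the rest of [0,1]. *)
Lemma integral_excess (R : realType) (f : R -> \bar R) (eps t : R) :
  {in `[0, 1] &, {homo f : x y / x <= y >-> (x <= y)%E}} ->
  (@lebesgue_measure R).-integrable `[0, eps] f ->
  0 < eps -> eps <= 1 -> f eps = t%:E ->
  (\int[@lebesgue_measure R]_(u in `[0%R, 1%R]) maxe (t%:E - f u) 0 =
   (eps * t)%:E - \int[@lebesgue_measure R]_(u in `[0%R, eps]) f u)%E.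
Proof.
move=> fmono fint e0 e1 fe.
have sub : `[0, eps] `<=` (`[0, 1] : set R).
  by move=> x /=; rewrite !in_itv/= => /andP[-> /le_trans->].
have eI : eps \in `[0, 1] by rewrite in_itv/= ltW.
rewrite -integral_cstB// -[in RHS](setIidr sub) integral_mkcondr.
apply: eq_integral => x; rewrite inE/= => xI; rewrite patchE.
have := xI; rewrite in_itv/= => /andP[x0 _].
case: ifPn; rewrite (inE, notin_setE)/= in_itv/= x0/= => xe.
  by apply/max_idPl; rewrite sube_ge0 ?orbT// -fe; exact: fmono.
apply/max_idPr; rewrite sube_le0 -fe; apply: fmono => //.
by apply/ltW; rewrite ltNge; apply/negP.
Qed.

(** A strictly increasing f stays, on the first half of [0,eps], at least
f eps - f (eps / 2) > 0 below its value at eps. *)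
Lemma integral_lt_right_end (R : realType) (f : R -> \bar R) (eps t : R) :
  {in `[0, eps] &, {homo f : x y / x < y >-> (x < y)%E}} ->
  (@lebesgue_measure R).-integrable `[0, eps] f ->
  0 < eps -> f eps = t%:E ->
  (\int[@lebesgue_measure R]_(u in `[0%R, eps]) f u < (eps * t)%:E)%E.
Proof.
move=> fmono fint e0 fe.
have mI : measurable (`[0, eps] : set (measurableTypeR R)).
  exact: measurable_itv.
have fle := le_mono_in fmono.
have eI : eps \in `[0, eps] by rewrite in_itv/= lexx ltW.
pose m := eps / 2.
have [m0 me] : 0 < m /\ m < eps.
  by rewrite divr_gt0// ltr_pdivrMr// ltr_pMr// ltr1n.
have mI1 : m \in `[0, eps] by rewrite in_itv/= !ltW.
have fm : (f m < t%:E)%E by rewrite -fe; exact: fmono.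
have mB : measurable_fun (`[0, eps] : set R) (fun u => t%:E - f u)%E.
  have := integrableB mI (lebesgue_integrable_cst eps t) fint.
  by case/integrableP.
have subm : `[0, m] `<=` (`[0, eps] : set R).
  by move=> x /=; rewrite !in_itv/= => /andP[-> /le_trans->//]; exact: ltW.
rewrite -sube_gt0 ?integrable_fin_num// -integral_cstB//.
apply: (@lt_le_trans _ _
    (\int[@lebesgue_measure R]_(u in `[0%R, m]) (t%:E - f m))%E).
  rewrite integral_cst// [X in (_ * X)%E](lebesgue_measure_0itv m0).
  by rewrite mule_gt0 ?lte_fin// sube_gt0.
apply: (@le_trans _ _
    (\int[@lebesgue_measure R]_(u in `[0%R, m]) (t%:E - f u))%E).
  apply: ge0_le_integral => //.
  - by move=> x _; rewrite sube_ge0 ?orbT ?ltW.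
  - exact: measurable_funS mB.
  move=> x xm; rewrite leeB// fle//; last exact: subm.
  by move: xm; rewrite /= in_itv/= => /andP[].
apply: ge0_subset_integral => // x /= xe; rewrite sube_ge0 ?orbT// -fe fle//.
by move: xe; rewrite in_itv/= => /andP[].
Qed.

(** * The bound *)

(** Stated for a measurable subset E of the event, because P is uncontrolled on
non-measurable sets. *)
Lemma increasing_mean_bound (R : realType) (f : R -> \bar R) (eps : R)
    d (T : measurableType d) (P : probability T R) (K : nat)
    (p : 'I_K -> {RV P >-> R}) (E : set T) :
  {in `[0, 1] &, {homo f : x y / x < y >-> (x < y)%E}} ->
  (@lebesgue_measure R).-integrable `[0, 1] f ->
  0 < eps -> eps <= 1 -> (0 < K)%N -> (forall k, uniform01 (p k)) ->
  measurable E -> (forall w k, E w -> p k w \in `[0, 1]) ->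
  (forall w, E w -> (\sum_(k < K) f (p k w)) * (K%:R^-1)%:E <=
    (eps^-1)%:E * \int[@lebesgue_measure R]_(u in `[0%R, eps]) f u)%E ->
  (P E <= eps%:E)%E.
Proof.
move=> fmono fint e0; rewrite le_eqVlt => /predU1P[->|e1] K0 up mE E01 Ec.
  exact: probability_le1.
have Kr0 : 0 < K%:R :> R by rewrite ltr0n.
have m01 (x : R) : 0 <= x -> x <= 1 -> x \in `[0, 1].
  by rewrite in_itv/= => -> ->.
(* An interior value of a strictly increasing function is finite. *)
have [t fe] : exists t, f eps = t%:E.
  have : (f 0%R < f eps)%E by apply: fmono => //; apply: m01 => //; exact: ltW.
  have : (f eps < f 1%R)%E by apply: fmono => //; apply: m01 => //; exact: ltW.
  case: (f eps) => [t|//|//]; first by exists t.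
    by rewrite ltNge leey.
  by move=> _; rewrite ltNge leNye.
have Isub : {subset `[0, eps] <= `[0, 1]}.
  by move=> x; rewrite !in_itv/= => /andP[-> /le_trans->//]; exact: ltW.
have finte : (@lebesgue_measure R).-integrable `[0, eps] f.
  by apply: integrableS fint.
have exE : _ = (_ - _)%E :=
  integral_excess (ltW_homo_in fmono) finte e0 (ltW e1) fe.
have ct := integral_lt_right_end (sub_in2 Isub fmono) finte e0 fe.
set I := (\int[@lebesgue_measure R]_(u in `[0%R, eps]) f u)%E in exE ct Ec.
have [i Ii] : exists i, I = i%:E.
  have /fineK <- : I \is a fin_num by exact: integrable_fin_num.
  by exists (fine I).
rewrite Ii in exE ct Ec.
rewrite lte_fin in ct.
have h0 (u : R) : u \in `[0, 1] -> (0 <= maxe (t%:E - f u) 0)%E.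
  by rewrite le_max lexx orbT.
pose a := K%:R * (t - eps^-1 * i).
have a0 : 0 < a by rewrite mulr_gt0// subr_gt0 ltr_pdivrMl.
have : (a%:E * P E <= K%:R%:E * ((eps * t)%:E - i%:E))%E.
  rewrite -exE; apply: markov_sum_uniform01 => //.
  - apply: measurable_maxe => //; apply: emeasurable_funB => //.
    by case/integrableP: fint.
  - move=> w Ew; apply: sum_excess_ge.
    by have := Ec w Ew; rewrite lee_pdivrMr// (mulrC K%:R) !EFinM.
  - exact: ltW.
rewrite -lee_pdivlMl// -EFinB -!EFinM => /le_trans; apply.
rewrite lee_fin ler_pdivrMl// le_eqVlt; apply/orP; left; apply/eqP.
by rewrite /a; field; rewrite gt_eqF.
Qed.

(* A real random variable with the uniform law may leave [0,1] on a null set,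
   where phi is undefined; the event is therefore taken among the outcomes at
   which all the p k lie in [0,1]. *)
Theorem theorem2 (R : realType) (phi : R -> \bar R) (psi : \bar R -> R)
    (phi_cont : {within `[0, 1], continuous phi})
    (phi_mono : strictly_monotonic01 phi)
    (phi_int : (@lebesgue_measure R).-integrable `[0, 1] phi)
    (phiK : {in `[0, 1], cancel phi psi})
    (K : nat) (K_ge2 : (2 <= K)%N)
    (eps : R) (eps_gt0 : 0 < eps) (eps_le1 : eps <= 1)
    (d : measure_display) (T : measurableType d) (P : probability T R)
    (p : 'I_K -> {RV P >-> R})
    (p_unif : forall k : 'I_K, uniform01 (p k)) :
  (P [set w | (forall k : 'I_K, (0 <= p k w <= 1)%R) /\
              (gen_mean phi psi (fun k => p k w)
               <= psi ((eps^-1)%:E *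
                       \int[@lebesgue_measure R]_(u in `[0%R, eps]) phi u)%E)%R]
   <= eps%:E)%E.
Proof.
have K0 : (0 < K)%N by exact: ltnW.
have I0 : (0 : R) \in `[0, 1] by rewrite in_itv/= lexx ler01.
have I1 : (1 : R) \in `[0, 1] by rewrite in_itv/= lexx ler01.
have Ieps : `[0, eps] `<=` (`[0, 1] : set R).
  by move=> x /=; rewrite !in_itv/= => /andP[-> /le_trans->].
have phi_inte : (@lebesgue_measure R).-integrable `[0, eps] phi.
  exact: integrableS phi_int.
pose S w := ((\sum_(k < K) phi (p k w)) * (K%:R^-1)%:E)%E.
set c := ((eps^-1)%:E * _)%E.
pose D := [set w | forall k, p k w \in `[0, 1]].
have mD : measurable D.
  rewrite (_ : D = \bigcap_(k in setT) (p k @^-1` `[0%R, 1%R])); last first.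
    by apply/seteqP; split => [w Dw k _|w Dw k]; exact: Dw.
  apply: fin_bigcap_measurable => // k _.
  by rewrite -[X in measurable X]setTI; exact: (measurable_funP (p k)).
have mI : measurable (`[0, 1] : set R) by exact: measurable_itv.
have mphi : measurable_fun (`[0, 1] : set R) phi by case/integrableP: phi_int.
have mS : measurable_fun D S.
  apply: emeasurable_funM => //; apply: emeasurable_sum => k.
  apply: (measurable_comp mI) => //.
  - by move=> _ [w Dw <-]; exact: Dw.
  - exact: measurable_funTS.
pose m := mine (phi 0) (phi 1); pose M := maxe (phi 0) (phi 1).
have mM : (m < M)%E.
  rewrite /m /M; case: phi_mono => h.
    by rewrite min_l ?max_r ?ltW// ; apply: h.
  by rewrite min_r ?max_l ?ltW// ; apply: h.
have phi_anti : {in `[0, 1] &, {homo phi : x y / x < y >-> (y < x)%E}} ->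
    {in `[0, 1] &, {mono phi : x y /~ (x <= y)%O}}.
  by move=> h; apply: le_nmono_in => x y xI yI; exact: h.
have phi_between u : u \in `[0, 1] -> (m <= phi u <= M)%E.
  move=> uI; have := uI; rewrite in_itv/= => /andP[u0 u1].
  rewrite /m /M ge_min le_max; case: phi_mono => h.
    by rewrite !(le_mono_in h)// u0 u1 orbT.
  by rewrite !(phi_anti h)// u0 u1 orbT.
(* On values between phi 0 and phi 1, psi is a two-sided inverse of phi. *)
have psiK v : (m <= v <= M)%E -> psi v \in `[0, 1] /\ phi (psi v) = v.
  move=> /(ereal_IVT ler01 phi_cont)[x x01 <-].
  by rewrite phiK.
have [pc01 pcE] : psi c \in `[0, 1] /\ phi (psi c) = c.
  by apply/psiK/average_between => // u /Ieps /phi_between.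
have pS w : D w -> psi (S w) \in `[0, 1] /\ phi (psi (S w)) = S w.
  by move=> Dw; apply/psiK/mean_between => // k; exact/phi_between/Dw.
have DE w : (forall k, 0 <= p k w <= 1) <-> D w.
  by split => Dw k; have := Dw k; rewrite /= in_itv.
(* The event is cut out of D by an inequality between S and c, whose direction
   depends on that of phi. *)
have fc : c \is a fin_num by rewrite fin_numM// integrable_fin_num.
case: phi_mono => phi_mono.
- rewrite (_ : [set w | _] = D `&` [set w | S w <= c]%E); last first.
    apply/seteqP; split => w [] /=.
      move=> /DE Dw; have [s01 sE] := pS w Dw.
      by rewrite -(le_mono_in phi_mono)// sE pcE.
    move=> Dw; have [s01 sE] := pS w Dw => h; split; first exact/DE.
    by rewrite -(le_mono_in phi_mono)// sE pcE.
  apply: (increasing_mean_bound (f := phi)) p_unif _ _ _ => //.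
  + exact: emeasurable_fun_infty_c.
  + by move=> w k [Dw _]; exact: Dw.
  + by move=> w [].
- rewrite (_ : [set w | _] = D `&` [set w | c <= S w]%E); last first.
    apply/seteqP; split => w [] /=.
      move=> /DE Dw; have [s01 sE] := pS w Dw.
      by rewrite -(phi_anti phi_mono)// sE pcE.
    move=> Dw; have [s01 sE] := pS w Dw => h; split; first exact/DE.
    by rewrite -(phi_anti phi_mono)// sE pcE.
  apply: (increasing_mean_bound (f := fun u => - phi u)%E) p_unif _ _ _ => //.
  + by move=> x y xI yI xy; rewrite lteN2; exact: phi_mono.
  + exact: integrableN.
  + exact: emeasurable_fun_c_infty.
  + by move=> w k [Dw _]; exact: Dw.
  + move=> w [_ /= cS]; rewrite integralN; last exact: integrable_add_def.
    rewrite muleN -/c lee_pdivrMr ?ltr0n// mulNe.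
    apply: sume_leN; first by rewrite fin_numM.
    by rewrite -lee_pdivlMr ?ltr0n.
Qed.
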